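(* Let $F$ be a digraph admitting a height function. Then $F$ is non-avoidable (i.e. not avoidable). More precisely, for every digraph $F$ admitting a height function, there exists an integer $k\ge 2$ such that, for every integer $r\ge k$, there is a (nonempty) oriented graph $D$ in which every vertex has out-degree exactly $r$ and such that every nonempty subdigraph of $D$ of minimum out-degree at least $k$ contains $F$.
   Context: All digraphs are finite and loopless, with no parallel arcs; digons (pairs of oppositely directed arcs $u\to v$, $v\to u$) are allowed. An oriented graph is a digraph with no digon. A height function on a digraph $F$ is a map $h:V(F)\to\mathbb Z$ such that $h(v)=h(u)+1$ for every arc $u\to v$ of $F$. A digraph contains $F$ if it has a (not necessarily induced) subdigraph isomorphic to $F$; otherwise it is $F$-free. The minimum out-degree $\delta^+(D)$ is the minimum of the out-degrees of the vertices of $D$. A digraph $F$ is avoidable if, for every positive integer $k$, there exists an integer $d$ such that every (nonempty) digraph of minimum out-degree at least $d$ contains a (nonempty) $F$-free subdigraph of minimum out-degree at least $k$. *)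

(* Defs.v *)
From HB Require Import structures.
From mathcomp Require Import all_boot all_order all_algebra.

Set Implicit Arguments.
Unset Strict Implicit.
Unset Printing Implicit Defensive.

(* Arcs form a relation, so parallel arcs are excluded while digons are not. *)
Record digraph := Digraph {
  vertex :> finType;
  arc : rel vertex;
  arc_irr : irreflexive arc
}.

Arguments arc {d}.

Definition nonempty (D : digraph) : Prop := 0 < #|D|.

Definition oriented (D : digraph) : Prop :=
  forall u v : D, ~~ (arc u v && arc v u).

Definition outdeg (D : digraph) (v : D) : nat := #|[set w : D | arc v w]|.

(* The default #|D| is at least every out-degree, so it does not affect the
   minimum when D is nonempty; the value on the empty digraph is 0. *)
Definition min_outdeg (D : digraph) : nat :=
  \big[minn/#|D|]_(v : D) outdeg v.

Lemma leq_min_outdeg (D : digraph) (k : nat) : nonempty D ->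
  k <= min_outdeg D <-> forall v : D, k <= outdeg v.
Proof.
move=> /card_gt0P[x _]; split=> [kD v|kD].
  apply: (leq_trans kD); rewrite /min_outdeg.
  elim: (index_enum D) (mem_index_enum v) => //= w s IHs.
  rewrite inE big_cons => /predU1P[->|/IHs]; first exact: geq_minl.
  by move=> le_v; rewrite geq_min le_v orbT.
rewrite /min_outdeg; elim/big_ind: _ => [|m n km kn|v _].
- exact: leq_trans (kD x) (max_card _).
- by rewrite leq_min km.
- exact: kD.
Qed.

Record subdigraph (D : digraph) := Subdigraph {
  sub_vertices : {set D};
  sub_arc : rel D;
  sub_arcP : forall u v : D, sub_arc u v ->
    [/\ u \in sub_vertices, v \in sub_vertices & arc u v]
}.

Section SubdigraphDigraph.
Variables (D : digraph) (H : subdigraph D).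

Definition subdigraph_arc : rel {x : D | x \in sub_vertices H} :=
  fun u v => sub_arc H (val u) (val v).

Lemma subdigraph_arc_irr : irreflexive subdigraph_arc.
Proof.
by move=> u; apply/negP => /sub_arcP[_ _]; rewrite arc_irr.
Qed.

Definition digraph_of_subdigraph : digraph := Digraph subdigraph_arc_irr.

End SubdigraphDigraph.

Coercion digraph_of_subdigraph : subdigraph >-> digraph.

Definition isomorphic (D E : digraph) : Prop :=
  exists2 f : D -> E, bijective f & {mono f : u v / arc u v}.

Definition contains (D F : digraph) : Prop :=
  exists H : subdigraph D, isomorphic H F.

Definition height_function (F : digraph) (h : F -> int) : Prop :=
  forall u v : F, arc u v -> h v = (h u + 1)%R.

Definition avoidable (F : digraph) : Prop :=
  forall k : nat, 0 < k ->
  exists d : nat, forall D : digraph, nonempty D -> d <= min_outdeg D ->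
  exists H : subdigraph D,
    [/\ nonempty H, k <= min_outdeg H & ~ contains H F].

(* Main.v *)
From mathcomp Require Import all_boot all_order all_algebra.
From mathcomp Require Import zify.
Require Import Defs.

Set Implicit Arguments.
Unset Strict Implicit.
Unset Printing Implicit Defensive.

(** A digraph [F] with a height function embeds into any large enough blow-up of a
    directed path: a sequence of disjoint layers, each of at least [k] vertices,
    with all arcs from each layer to the next. So it is enough to build, for every
    [r >= k], an [r]-out-regular oriented graph [D] in which every subdigraph [H] of
    minimum out-degree at least [k] contains such a blow-up. Since [H] may keep any
    [k] of the [r] arcs that leave a vertex, think of [H] as the play of an opponent.

    Suppose that the vertices of some set, called sites, all have the same [r]
    out-neighbours. The opponent then colours each site by the subset of
    out-neighbours that it keeps. Any [k] sites of one colour and the out-neighbours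
    that they keep form two complete layers. So [D] should confront the opponent
    with a vertex whose [r] out-neighbours are sites of one colour, but it has to do
    so without knowing the colouring. It can come close to knowing it. Start from the list of all colourings. At a vertex
    with a list of at least [r] colourings, put [r] out-neighbours, each of which
    deletes a different colouring from the list. As [H] keeps at least two of them,
    one of them keeps the colouring that the opponent is actually using
    ([shrink_keeps]). Following these choices, [H] contains a vertex with fewer than
    [r] colourings, the right one among them ([reach_short_list]). With enough sites
    there is a block of [r] sites on which all of these colourings are constant
    ([monochromatic_block]); it serves whichever of them is the right one.

    For more layers, this is nested. At a short list, instead of entering its block,
    put the list on a stack and start again with the list of all colourings of a
    fresh copy of the sites, whose common out-neighbours are the block of the list
    on top of the stack. Since the block is known when the fresh copy is built, the
    colouring to be guessed is well defined: it is indexed by the stack. Once the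
    stack holds [M] lists, enter the block of the current list, and from then on pop
    the stack; each pop moves on to the block of the popped list. When the stack is
    empty, restart. Every [H] contains a descent whose stacked lists all contain the
    right colouring ([reach_full_stack]), and the subsequent ascent runs through
    [M.+1] layers, completely joined because each block is monochromatic
    ([closed_contains_layers]). *)

(** * Copies of a digraph *)

Lemma contains_inj (D F : digraph) (f : F -> D) : injective f ->
  (forall u v, arc u v -> arc (f u) (f v)) -> contains D F.
Proof.
move=> f_inj f_arc.
pose A : {set D} := [set f u | u : F].
pose e (a b : D) := [exists u : F, exists v : F, [&& arc u v, a == f u & b == f v]].
have eP a b : e a b -> [/\ a \in A, b \in A & arc a b].
  case/existsP=> u /existsP[v /and3P[uv /eqP-> /eqP->]].
  by split; [exact: imset_f | exact: imset_f | exact: f_arc].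
pose H := Subdigraph eP.
have fA u : f u \in sub_vertices H by apply: imset_f.
pose g (u : F) : H := exist _ (f u) (fA u).
have g_inj : injective g by move=> u v /(congr1 val)/f_inj.
have g_bij : bijective g.
  apply: inj_card_bij => //.
  rewrite [leqLHS]card_sig -(card_imset predT f_inj).
  by apply: subset_leq_card; apply/subsetP.
exists H; case: (g_bij) => h gK hK; exists h; first by exists g.
have g_mono u v : arc (g u) (g v) = arc u v.
  apply/existsP/idP => [[u' /existsP[v' /and3P[uv]]]|uv].
    by move=> /eqP/= /f_inj-> /eqP/= /f_inj->.
  by exists u; apply/existsP; exists v; rewrite uv /= !eqxx.
by move=> a b; rewrite -g_mono !hK.
Qed.

(** Shifting by the sum of all absolute values makes any height function natural. *)
Lemma bounded_height (F : digraph) (h : F -> int) : height_function h ->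
  exists M, exists2 h' : F -> nat, (forall v, h' v <= M) &
    forall u v : F, arc u v -> h' v = (h' u).+1.
Proof.
move=> hh; pose a := \sum_(v : F) `|h v|%N.
have h_le v : `|h v|%N <= a by rewrite /a (bigD1 v) //= leq_addr.
exists a.*2; exists (fun v => `|(h v + a%:R)%R|%N) => [v|u v /hh ->].
  by have := h_le v; lia.
by have := h_le u; lia.
Qed.

(** * Pigeonhole *)

Lemma large_fibre (A B : finType) (n : nat) (g : A -> B) : 0 < #|A| ->
  n * #|B| <= #|A| -> exists b, n <= #|[set a | g a == b]|.
Proof.
move=> A_gt0 le_nA; apply/existsP; apply: contraT => /existsPn small.
have B_gt0 : 0 < #|B| by case/card_gt0P: A_gt0 => a _; apply/card_gt0P; exists (g a).
have : #|A| < n * #|B|; last by rewrite ltnNge le_nA.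
rewrite -sum1_card (partition_big g xpredT) //= mulnC -sum_nat_const.
rewrite (eq_bigr (fun b => #|[set a | g a == b]|)); last first.
  by move=> b _; rewrite -sum1_card; apply: eq_bigl => a; rewrite inE.
case/card_gt0P: B_gt0 => b0 _.
rewrite [X in X < _](bigD1 b0) // [X in _ < X](bigD1 b0) //=.
rewrite -addSn leq_add //; first by rewrite ltnNge small.
by apply: leq_sum => b _; rewrite ltnW // ltnNge small.
Qed.

Section Construction.

Variables (r M : nat).
Hypothesis r_gt1 : 1 < r.

Let r_gt0 : 0 < r. Proof. exact: ltnW. Qed.


(** * Lists of colourings and monochromatic blocks *)

(** A colour records which of the [r] out-neighbours of a site a subgraph keeps.
    Fewer than [r] colourings give each site a profile in [{ffun 'I_r -> colour}].
    Sites are pairs only so that there are [r] times as many of them as profiles. *)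
Local Notation colour := {set 'I_r}.
Local Notation site := ('I_r * {ffun 'I_r -> colour})%type.
Local Notation colouring := {ffun site -> colour}.

Implicit Types (J K : {set colouring}) (c : colouring).

Definition candidate (J : {set colouring}) (y : 'I_r) : colouring :=
  nth [ffun => set0] (enum J) y.

Definition shrink (J : {set colouring}) (y : 'I_r) := J :\ candidate J y.

Lemma candidate_inj J : r <= #|J| -> injective (candidate J).
Proof.
move=> leJ y z /eqP; rewrite nth_uniq ?enum_uniq -?cardE //.
- by move/eqP/val_inj.
- exact: leq_trans leJ.
- exact: leq_trans leJ.
Qed.

Lemma candidate_in J y : r <= #|J| -> candidate J y \in J.
Proof. by move=> leJ; rewrite -mem_enum mem_nth // -cardE (leq_trans _ leJ). Qed.

Lemma shrink_inj J : r <= #|J| -> injective (shrink J).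
Proof.
move=> leJ y z eq_yz; apply: (candidate_inj leJ); apply/eqP.
have := setD11 (candidate J y) J; rewrite -/(shrink J y) eq_yz !inE.
by rewrite candidate_in // andbT => /negbFE.
Qed.

Lemma card_shrink J y : r <= #|J| -> #|shrink J y| < #|J|.
Proof. by move=> leJ; rewrite [ltnRHS](cardsD1 (candidate J y)) candidate_in. Qed.

(** Whoever keeps two of the [r] ways to shrink a list cannot delete [c] in both,
    as the deleted colourings differ. *)
Lemma shrink_keeps (J : {set colouring}) (c : colouring) (X : {set 'I_r}) :
  r <= #|J| -> c \in J -> 1 < #|X| -> exists2 y, y \in X & c \in shrink J y.
Proof.
move=> leJ cJ /card_gt1P[y [z [yX zX neq_yz]]].
have [eq_c|neq_c] := eqVneq c (candidate J y); last first.
  by exists y => //; rewrite !inE neq_c.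
exists z => //; rewrite !inE cJ andbT eq_c.
by apply: contra neq_yz => /eqP/(candidate_inj leJ)->.
Qed.

Lemma leq_card_colourings : r <= #|[set: colouring]|.
Proof.
rewrite cardsT card_ffun -cardsT -powersetT card_powerset cardsT card_ord.
rewrite (leq_trans (ltnW (ltn_expl r (ltnSn 1)))) // -[leqLHS]expn1.
rewrite leq_pexp2l ?expn_gt0 //.
by apply/card_gt0P; exists (Ordinal r_gt0, [ffun => set0]).
Qed.

Definition monochromatic (J : {set colouring}) (f : {ffun 'I_r -> site}) :=
  [forall c in J, [forall y, [forall z, c (f y) == c (f z)]]].

(** Sites with the same profile, that is, the same colour under each colouring of
    [J], form a monochromatic set; one profile is shared by [r] sites. *)
Lemma monochromatic_block (J : {set colouring}) : #|J| < r ->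
  exists f : {ffun 'I_r -> site}, injectiveb f && monochromatic J f.
Proof.
move=> ltJ.
(* Indices past the end of the list [J] repeat a default colouring. *)
pose profile (s : site) : {ffun 'I_r -> colour} := [ffun i => candidate J i s].
have [||p le_p] := @large_fibre _ _ r profile.
- by apply/card_gt0P; exists (Ordinal r_gt0, [ffun => set0]).
- by rewrite card_prod card_ord.
set E := [set s | _] in le_p.
pose s0 : site := (Ordinal r_gt0, [ffun => set0]).
pose f := [ffun y : 'I_r => nth s0 (enum E) y].
have fE y : f y \in E by rewrite ffunE -mem_enum mem_nth // -cardE (leq_trans _ le_p).
exists f; apply/andP; split.
  apply/injectiveP => y z /eqP; rewrite !ffunE nth_uniq ?enum_uniq -?cardE //.
  - by move/eqP/val_inj.
  - exact: leq_trans le_p.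
  - exact: leq_trans le_p.
apply/forall_inP => c cJ; apply/forallP => y; apply/forallP => z.
have idx_lt : index c (enum J) < r.
  by apply: leq_trans ltJ; rewrite cardE ltnS index_size.
have cE s : s \in E -> c s = p (Ordinal idx_lt).
  by rewrite inE => /eqP <-; rewrite ffunE /candidate /= nth_index ?mem_enum.
by rewrite !cE.
Qed.

(** The fallback keeps the block injective for long lists too, so that out-degrees
    are [r] at every state. *)
Definition block (J : {set colouring}) : {ffun 'I_r -> site} :=
  odflt [ffun y => (y, [ffun => set0])]
    [pick f : {ffun 'I_r -> site} | injectiveb f && monochromatic J f].

Lemma block_inj J : injective (block J).
Proof.
rewrite /block; case: pickP => [f /andP[/injectiveP] //|_ y z].
by rewrite /= !ffunE => -[].
Qed.

Lemma block_mono (J : {set colouring}) (c : colouring) y z :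
  #|J| < r -> c \in J -> c (block J y) = c (block J z).
Proof.
move=> ltJ cJ; rewrite /block; case: pickP => [f /andP[_ /forall_inP]|none].
  by move=> /(_ c cJ)/forallP/(_ y)/forallP/(_ z)/eqP.
by have [f] := monochromatic_block ltJ; rewrite none.
Qed.

(** * The digraph *)

Local Notation stack := (seq {set colouring}).
(** A state carries the short lists put aside so far, the last one on top, together
    with the list being shortened (descent) or a site (ascent). *)
Definition state : finType := (({set colouring} + site) * M.-bseq {set colouring})%type.

Definition down (J : {set colouring}) (t : stack) : state := (inl J, insub_bseq M t).
Definition up (s : site) (t : stack) : state := (inr s, insub_bseq M t).

(** The descent enters the full list [setT] by way of its shortenings: the state
    before it has these as its own out-neighbours. *)
Definition out (u : state) (y : 'I_r) : state :=
  match u.1 with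
  | inl J =>
    if r <= #|J| then down (shrink J y) u.2
    else if size u.2 < M then down (shrink setT y) (J :: u.2)
    else up (block J y) u.2
  | inr s =>
    if bseqval u.2 is J :: t then up (block J y) t else down (shrink setT y) [::]
  end.

Lemma insub_stackK (t : stack) : size t <= M -> bseqval (insub_bseq M t) = t.
Proof. exact: (@insubdK _ _ (M.-bseq {set colouring})). Qed.

Lemma insub_bseqval (t : M.-bseq {set colouring}) : insub_bseq M t = t.
Proof. by apply: val_inj; apply: insub_stackK; apply: size_bseq. Qed.

Variant state_spec : state -> Type :=
  | Down J (t : stack) of size t <= M : state_spec (down J t)
  | Up s (t : stack) of size t <= M : state_spec (up s t).

Lemma stateP u : state_spec u.
Proof.
case: u => [[J|s] t]; rewrite -[t]insub_bseqval; constructor; exact: size_bseq.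
Qed.

Lemma out_shrink J t y : size t <= M -> r <= #|J| ->
  out (down J t) y = down (shrink J y) t.
Proof. by move=> tM leJ; rewrite /out /= leJ insub_stackK. Qed.

Lemma out_push J t y : size t < M -> #|J| < r ->
  out (down J t) y = down (shrink setT y) (J :: t).
Proof. by move=> tM ltJ; rewrite /out /= leqNgt ltJ insub_stackK ?tM // ltnW. Qed.

Lemma out_turn J t y : size t = M -> #|J| < r ->
  out (down J t) y = up (block J y) t.
Proof. by move=> tM ltJ; rewrite /out /= leqNgt ltJ insub_stackK tM // ltnn. Qed.

Lemma out_pop s J t y : size t < M -> out (up s (J :: t)) y = up (block J y) t.
Proof. by move=> tM; rewrite /out /= insub_stackK. Qed.

Lemma out_restart s y : out (up s [::]) y = down (shrink setT y) [::].
Proof. by rewrite /out /= insub_stackK. Qed.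

Lemma down_inj t : injective (down^~ t).
Proof. by move=> J K []. Qed.

Lemma up_inj t : injective (up^~ t).
Proof. by move=> J K []. Qed.

Lemma out_inj u : injective (out u).
Proof.
case: (stateP u) => [J|s] t tM y z.
  have [ltJ|leJ] := ltnP #|J| r; last first.
    by rewrite !out_shrink // => /down_inj/(shrink_inj leJ).
  have [tM'|Mt] := ltnP (size t) M.
    by rewrite !out_push // => /down_inj/(shrink_inj leq_card_colourings).
  have {}tM : size t = M by apply/eqP; rewrite eqn_leq tM.
  by rewrite !out_turn // => /up_inj/block_inj.
case: t tM => [_|J t tM].
  by rewrite !out_restart => /down_inj/(shrink_inj leq_card_colourings).
by rewrite !out_pop // => /up_inj/block_inj.
Qed.

(** Strictly above the size of every list of colourings. *)
Definition list_bound : nat := #|{set colouring}|.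

(** Lexicographic during the descent: first the height of the stack, then the
    number of colourings deleted from the current list. Ascending states lie above
    all descending ones, ordered by how much of the stack has been popped. *)
Definition rank (u : state) : nat :=
  match u.1 with
  | inl J => size u.2 * list_bound.+1 + (list_bound - #|J|)
  | inr _ => M.+1 * list_bound.+1 + (M - size u.2)
  end.

Lemma card_lt_sets (J : {set colouring}) : #|J| < list_bound.
Proof.
rewrite /list_bound -cardsT -powersetT card_powerset.
by rewrite (leq_ltn_trans (subset_leq_card (subsetT J))) // ltn_expl.
Qed.

Lemma rank_out u y : (forall s, u <> up s [::]) -> rank u < rank (out u y).
Proof.
case: (stateP u) => [J|s] t tM.
  move=> _; have [ltJ|leJ] := ltnP #|J| r; last first.
    rewrite out_shrink // /rank /= insub_stackK //.
    rewrite ltn_add2l ltn_sub2l ?card_shrink //.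
    exact: ltn_trans (card_shrink y leJ) (card_lt_sets J).
  have := card_lt_sets J; have [tM'|Mt] := ltnP (size t) M.
    by rewrite out_push // /rank /= !insub_stackK //= mulSn; lia.
  have {}tM : size t = M by apply/eqP; rewrite eqn_leq tM.
  by rewrite out_turn // /rank /= !insub_stackK tM //= mulSn; lia.
case: t tM => [_ /(_ s) //|J t /= tM _].
by rewrite out_pop // /rank /= !insub_stackK //=; lia.
Qed.

(** The rank can only drop along an arc that restarts, and what follows a
    restart is again a descending state: with [M > 0], an empty stack is not full,
    so the next arc cannot turn. *)
Lemma no_digon u y z : 0 < M -> out (out u y) z <> u.
Proof.
move=> M_gt0.
have no_return s w x s' : out (out (up s [::]) w) x <> up s' [::].
  rewrite out_restart; set J := shrink _ _.
  have [ltJ|leJ] := ltnP #|J| r; first by rewrite out_push.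
  by rewrite out_shrink.
have [s /eqP -> /no_return //|u_up] := pickP (fun s => u == up s [::]).
have [s /eqP eq_v eq_u|v_up] := pickP (fun s => out u y == up s [::]).
  by apply: (no_return s z y s); rewrite -eq_v eq_u.
have lt_uv : rank u < rank (out u y).
  by apply: rank_out => s /eqP; rewrite u_up.
have lt_vu : rank (out u y) < rank (out (out u y) z).
  by apply: rank_out => s /eqP; rewrite v_up.
by move=> eq_u; move: (ltn_trans lt_uv lt_vu); rewrite eq_u ltnn.
Qed.

Section Digraph.

Hypothesis M_gt0 : 0 < M.

Definition state_arc : rel state := fun u v => [exists y, out u y == v].

Lemma state_arcN u v : ~~ (state_arc u v && state_arc v u).
Proof.
apply/negP => /andP[/existsP[y /eqP <-] /existsP[z /eqP]].
exact: no_digon.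
Qed.

Lemma state_arc_irr : irreflexive state_arc.
Proof. by move=> u; apply: negbTE; have := state_arcN u u; rewrite andbb. Qed.

Definition state_digraph := Digraph state_arc_irr.

Lemma outdeg_state (u : state_digraph) : outdeg u = r.
Proof.
rewrite -[RHS]card_ord -(card_codom (@out_inj u)) /outdeg.
apply: eq_card => v; rewrite inE; apply/existsP/codomP => [[y /eqP <-]|[y ->]].
  by exists y.
by exists y.
Qed.

End Digraph.

(** * Layers in a closed set of states *)

(** [W] stands for the vertices of a subgraph of minimum out-degree at least [k],
    and [chosen u] for the indices of the arcs from [u] that the subgraph keeps. *)
Section Closed.

Variables (k : nat) (W : {set state}) (chosen : state -> colour).
Hypothesis k_gt1 : 1 < k.
Hypothesis chosen_card : forall u, u \in W -> k <= #|chosen u|.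
Hypothesis chosen_out : forall u y, u \in W -> y \in chosen u -> out u y \in W.

(** The colouring that the subgraph uses on the sites above the stack [t]; it does
    not depend on the list that the descent above [t] has reached. *)
Definition induced (t : stack) : colouring := [ffun s => chosen (up s t)].

(** Each list of [L] is short and contains the colouring that will be met when the
    ascent reaches it, with the lists below it as the stack. *)
Fixpoint prophetic (L : stack) : bool :=
  if L is J :: t then [&& #|J| < r, induced t \in J & prophetic t] else true.

Lemma chosen_gt1 u : u \in W -> 1 < #|chosen u|.
Proof. by move/chosen_card; apply: leq_trans. Qed.

Lemma some_out u : u \in W -> exists y, out u y \in W.
Proof.
move=> uW; have /card_gt0P[y yu] := ltnW (chosen_gt1 uW).
by exists y; apply: chosen_out.
Qed.

(** The rank is bounded and only a restart lets it drop. *)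
Lemma reach_empty_stack u : u \in W -> exists s, up s [::] \in W.
Proof.
have [n] := ubnP (M.+1 * list_bound.+1 + M - rank u).
elim: n u => // n IHn u; rewrite ltnS => le_n uW.
have [s /eqP us|u_up] := pickP (fun s => u == up s [::]); first by exists s; rewrite -us.
have [y yW] := some_out uW; apply: IHn yW.
have lt_rank : rank u < rank (out u y).
  by apply: rank_out => s us; have := u_up s; rewrite us eqxx.
have le_rank : rank (out u y) <= M.+1 * list_bound.+1 + M.
  case: (stateP (out u y)) => [J|s] t tM; rewrite /rank /= insub_stackK //; last by lia.
  rewrite mulSn; have := leq_mul tM (leqnn list_bound.+1); lia.
lia.
Qed.

(** The successors of [u] are given by a hypothesis because [u] is either the
    state that holds the list [J] itself or the state from which the descent enters
    the full list. *)
Lemma branch_keeps u (J : {set colouring}) t c : u \in W ->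
  out u =1 (fun y => down (shrink J y) t) -> r <= #|J| -> c \in J ->
  exists2 K : {set colouring}, c \in K & down K t \in W /\ #|K| < #|J|.
Proof.
move=> uW out_u leJ cJ.
have [y yu cK] := shrink_keeps leJ cJ (chosen_gt1 uW).
exists (shrink J y) => //; split; last exact: card_shrink.
by rewrite -out_u; apply: chosen_out.
Qed.

Lemma reach_short_list J t c : size t <= M -> down J t \in W -> c \in J ->
  exists2 K : {set colouring}, down K t \in W & (#|K| < r) && (c \in K).
Proof.
move=> tM; have [n] := ubnP #|J|; elim: n J => // n IHn J; rewrite ltnS => le_n JW cJ.
have [ltJ|leJ] := ltnP #|J| r; first by exists J => //; rewrite ltJ.
have [K cK [KW ltK]] := branch_keeps JW (fun y => out_shrink y tM leJ) leJ cJ.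
by apply: IHn KW cK; apply: leq_trans le_n.
Qed.

(** Starting from a restart, shorten the list while keeping the induced colouring,
    push, and repeat until the stack is full. *)
Lemma reach_full_stack : W != set0 ->
  exists J t, [/\ size t = M, down J t \in W & prophetic (J :: t)].
Proof.
case/set0Pn=> u /reach_empty_stack[s sW].
suff: forall n, n <= M -> exists J t, [/\ size t = n, down J t \in W & prophetic (J :: t)].
  exact.
have enter v t : size t <= M -> v \in W -> prophetic t ->
    out v =1 (fun y => down (shrink setT y) t) ->
    exists J, down J t \in W /\ prophetic (J :: t).
  move=> tM vW t_ok out_v.
  have [K cK [KW _]] := branch_keeps vW out_v leq_card_colourings (in_setT (induced t)).
  have [J JW /andP[ltJ cJ]] := reach_short_list tM KW cK.
  by exists J; rewrite /= ltJ cJ.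
elim=> [_|n IHn ltn].
  have [//|J [JW J_ok]] := enter _ [::] (leq0n M) sW isT.
    exact: out_restart.
  by exists J, [::].
have [J [t [tn JW Jt_ok]]] := IHn (ltnW ltn).
have tM : size t < M by rewrite tn.
have ltJ : #|J| < r by case/andP: Jt_ok.
have [K [KW K_ok]] := enter _ (J :: t) tM JW Jt_ok (fun y => out_push y tM ltJ).
by exists K, (J :: t); rewrite /= tn.
Qed.

Lemma prophetic_nth L i : prophetic L -> i < size L ->
  #|nth set0 L i| < r /\ induced (drop i.+1 L) \in nth set0 L i.
Proof.
elim: L i => // J t IHt [|i] /= /and3P[ltJ cJ t_ok] lt_i; last exact: IHt.
by rewrite drop0.
Qed.

(** [X i] indexes a part of the [i]-th block that lies in [W]. The block is
    monochromatic for the induced colouring, so all its sites keep the same arcs;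
    their common colour is the index set [X i.+1] of the next layer. Layers differ
    in the height of the stack, hence are disjoint. *)
Lemma closed_contains_layers : W != set0 ->
  exists (B : nat -> 'I_r -> state) (X : nat -> {set 'I_r}),
  [/\ forall i j y z, i <= M -> j <= M -> B i y = B j z -> i = j /\ y = z,
      forall i, i <= M -> k <= #|X i| /\ {in X i, forall y, B i y \in W} &
      forall i y z, i < M -> y \in X i -> z \in X i.+1 ->
        z \in chosen (B i y) /\ out (B i y) z = B i.+1 z].
Proof.
case/reach_full_stack => J0 [t0 [t0M J0W]]; set L := J0 :: t0 => L_ok.
have sizeL : size L = M.+1 by rewrite /= t0M.
pose y0 := Ordinal r_gt0.
pose J i := nth set0 L i.
pose B i y := up (block (J i) y) (drop i.+1 L).
(* Any [y0] would do: the colour is constant on the block. *)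
pose X i := if i is j.+1 then chosen (B j y0) else chosen (down J0 t0).
have drop_le i : size (drop i.+1 L) <= M by rewrite size_drop sizeL subSS leq_subr.
have chosenB i y : i <= M -> chosen (B i y) = X i.+1.
  rewrite -ltnS -sizeL => lt_i; have [ltJ cJ] := prophetic_nth L_ok lt_i.
  by have := block_mono y y0 ltJ cJ; rewrite !ffunE.
have outB i y z : i < M -> out (B i y) z = B i.+1 z.
  move=> ltiM; rewrite /B (drop_nth set0) ?sizeL ?ltnS // out_pop //.
  by rewrite size_drop sizeL; lia.
have XW i : i <= M -> k <= #|X i| /\ {in X i, forall y, B i y \in W}.
  elim: i => [_|i IHi ltiM].
    split=> [|y yX]; first exact: chosen_card.
    have ltJ : #|J0| < r by case/andP: L_ok.
    by have := chosen_out J0W yX; rewrite out_turn // /B /= drop0.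
  have [leX inW] := IHi (ltnW ltiM).
  have /card_gt0P[y yX] : 0 < #|X i| by apply: leq_trans leX; apply: ltnW.
  have yW := inW _ yX; rewrite -(chosenB i y) ?(ltnW ltiM) //; split=> [|z zX].
    exact: chosen_card.
  by rewrite -(outB i y) //; apply: chosen_out.
exists B, X; split=> // [i j y z leiM lejM eqB|i y z ltiM yX zX]; last first.
  by rewrite (chosenB i y (ltnW ltiM)) outB.
have eq_ij : i = j.
  have /(congr1 (fun u : state => size u.2)) := eqB.
  by rewrite /= !insub_stackK // !size_drop t0M; lia.
by split=> //; move: eqB; rewrite eq_ij => /up_inj/block_inj.
Qed.

End Closed.

End Construction.

(** A vertex of height [i] goes to the [i]-th layer. Its place there is its rank in
    an enumeration of all of [F], so that vertices of equal height stay apart; the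
    layers are large enough because [#|F| <= k]. *)
Lemma state_subdigraph_contains (r M k : nat) (r_gt1 : 1 < r) (M_gt0 : 0 < M)
    (F : digraph) (h : F -> nat) (H : subdigraph (state_digraph r_gt1 M_gt0)) :
  1 < k -> #|F| <= k -> (forall v, h v <= M) ->
  (forall u v : F, arc u v -> h v = (h u).+1) ->
  nonempty H -> k <= min_outdeg H -> contains H F.
Proof.
move=> k_gt1 leFk h_le h_arc H_ne /(leq_min_outdeg k H_ne) degH.
pose W : {set state r M} := sub_vertices H.
pose chosen (u : state r M) := [set y : 'I_r | sub_arc H u (out u y)].
have chosen_card u : u \in W -> k <= #|chosen u|.
  move=> uW; apply: leq_trans (degH (exist _ u uW)) _.
  rewrite /outdeg -(card_imset _ val_inj) -(card_imset (chosen u) (@out_inj r M r_gt1 u)).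
  apply: subset_leq_card; apply/subsetP => _ /imsetP[w uw ->].
  move: uw; rewrite inE => uw; have [_ _ /existsP[y /eqP out_y]] := sub_arcP uw.
  by apply/imsetP; exists y; rewrite // inE out_y.
have chosen_out u y : u \in W -> y \in chosen u -> out u y \in W.
  by move=> _; rewrite inE => /sub_arcP[].
have W_ne : W != set0.
  by case/card_gt0P: H_ne => u _; apply/set0Pn; exists (val u); apply: valP.
have [B [X [B_inj XW B_arc]]] :=
  closed_contains_layers r_gt1 k_gt1 chosen_card chosen_out W_ne.
pose y0 : 'I_r := Ordinal (ltnW r_gt1).
pose pos v := nth y0 (enum (X (h v))) (enum_rank v).
have rank_lt v : enum_rank v < size (enum (X (h v))).
  by rewrite -cardE (leq_trans (ltn_ord _)) // (leq_trans leFk) //; case: (XW _ (h_le v)).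
have posX v : pos v \in X (h v) by rewrite -mem_enum mem_nth.
have fW v : B (h v) (pos v) \in sub_vertices H by case: (XW _ (h_le v)) => _; apply.
apply: (@contains_inj _ _ (fun v => exist _ (B (h v) (pos v)) (fW v) : H)).
  move=> u v /(congr1 val)/= /B_inj[//|//|eq_h].
  rewrite /pos eq_h => /eqP; rewrite nth_uniq ?enum_uniq ?rank_lt -?eq_h ?rank_lt //.
  by move/eqP/val_inj/enum_rank_inj.
move=> u v /h_arc hv; have lt_u : h u < M by rewrite -hv.
have vX : pos v \in X (h u).+1 by rewrite -hv.
have [] := B_arc _ _ _ lt_u (posX u) vX.
by rewrite inE => uv out_eq; rewrite /= /arc /= /subdigraph_arc /= hv -out_eq.
Qed.

Theorem theorem1p1 (F : digraph)
    (hF : exists h : F -> int, height_function h) :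
  ~ avoidable F /\
  exists k : nat, 2 <= k /\
    forall r : nat, k <= r ->
    exists D : digraph,
      [/\ nonempty D,
          oriented D,
          (forall v : D, outdeg v = r) &
          forall H : subdigraph D,
            nonempty H -> k <= min_outdeg H -> contains H F].
Proof.
have [h0 /bounded_height[M [h h_le h_arc]]] := hF.
pose k := maxn 2 #|F|.
have k_gt1 : 1 < k by rewrite leq_maxl.
have main r : k <= r -> exists D : digraph,
    [/\ nonempty D, oriented D, (forall v : D, outdeg v = r) &
        forall H : subdigraph D, nonempty H -> k <= min_outdeg H -> contains H F].
  move=> le_kr; have r_gt1 := leq_trans k_gt1 le_kr.
  exists (state_digraph r_gt1 (ltn0Sn M)); split.
  - by apply/card_gt0P; exists (down M.+1 (set0 : {set _}) [::]).
  - exact: state_arcN.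
  - exact: outdeg_state.
  - move=> H; apply: (state_subdigraph_contains k_gt1 _ _ h_arc).
      exact: leq_maxr.
    by move=> v; apply: leqW.
split; last by exists k.
(* For any proposed [d], regularity of degree [maxn k d] refutes avoidability. *)
move=> /(_ k (ltnW k_gt1))[d avoid].
have [D [D_ne _ degD inD]] := main _ (leq_maxl k d).
have [|H [H_ne degH []]] := avoid D D_ne; last exact: inD.
by apply/leq_min_outdeg => // v; rewrite degD leq_maxr.
Qed.
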